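(* Let $H$ be a separable infinite-dimensional complex Hilbert space, let $\mathcal{A}=B_{sk}(H)$ or $\mathcal{A}=\mathcal{K}_{sk}(H)$, and let $\Omega$ be a topological space. Let $\mathcal{L}$ be one of the Lie algebras $F(\Omega,\mathcal{A})$ (all maps from $\Omega$ to $\mathcal{A}$) or $C(\Omega,\mathcal{A})$ (all continuous maps from $\Omega$ to $\mathcal{A}$), and let $\nabla$ be a local spatial derivation on $\mathcal{L}$ implemented by elements from $F(\Omega,B_{sk}(H))$. Suppose that, for every $t\in\Omega$, the map $\phi_t\nabla\psi$ is ultraweakly continuous on $B_{sk}(H)$. Then $\nabla$ is a spatial derivation.
   Context: $B(H)$ is the algebra of all bounded linear operators on $H$, $B_{sk}(H)=\{a\in B(H):a^*=-a\}$, and $\mathcal{K}_{sk}(H)$ is the set of skew-adjoint compact operators on $H$; both are Lie algebras under $[a,b]=ab-ba$. $F(\Omega,B_{sk}(H))$ is the Lie algebra of all maps from $\Omega$ to $B_{sk}(H)$; spaces of maps carry the pointwise bracket $[a,b](t)=[a(t),b(t)]$. For $t\in\Omega$, $\phi_t:F(\Omega,B(H))\to B(H)$ is evaluation, $\phi_t(x)=x(t)$, and $\psi:B(H)\to F(\Omega,B(H))$ is $\psi(a)=\hat a$, the constant map $\Omega\to\{a\}$; thus $\phi_t\nabla\psi$ is the map $x\mapsto \nabla(\hat x)(t)$. Definitions. Let $B$ be a Lie subalgebra of a Lie algebra $A$. A derivation $D$ on $B$ is spatial if it is implemented by an element of $A$, i.e. there is $a\in A$ with $D(x)=[a,x]$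 for all $x\in B$ (here $B=\mathcal{L}$ and $A=F(\Omega,B_{sk}(H))$). A local derivation on $B$ is a linear map $\nabla:B\to B$ such that for every $x\in B$ there is a derivation $D$ of $B$ with $\nabla(x)=D(x)$. A local derivation $\nabla$ on $B$ is a local spatial derivation implemented by elements from $A$ if for every $x\in B$ there is a spatial derivation $D$ on $B$ implemented by an element of $A$ such that $\nabla(x)=D(x)$. *)

(* Defs.v *)
From HB Require Import structures.
From mathcomp Require Import all_boot all_order all_algebra.
From mathcomp Require Import complex.
From mathcomp Require Import all_classical all_reals all_analysis.

Set Implicit Arguments.
Unset Strict Implicit.
Unset Printing Implicit Defensive.

Import Order.TTheory GRing.Theory Num.Theory.
Import numFieldNormedType.Exports.

Local Open Scope classical_set_scope.
Local Open Scope ring_scope.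
Local Open Scope complex_scope.


Section BoundedOperators.
Context {R : realType} {H : normedModType R[i]}.

Definition is_bounded_linear (a : H -> H) : Prop :=
  linear a /\ exists M : R, forall u, `|a u| <= M%:C * `|u|.

Definition bounded_linear_pred : {pred H -> H} :=
  [pred a | `[< is_bounded_linear a >]].

Lemma bounded_linearP (a : H -> H) :
  reflect (is_bounded_linear a) (a \in bounded_linear_pred).
Proof. exact: asboolP. Qed.

Lemma ReK_norm (u : H) : (complex.Re `|u|)%:C = `|u|.
Proof. by rewrite RRe_real// realE normr_ge0. Qed.

Lemma ReK_normC (k : R[i]) : (complex.Re `|k|)%:C = `|k|.
Proof. by rewrite RRe_real// realE normr_ge0. Qed.

Lemma bounded_linear_submod_closed : submod_closed bounded_linear_pred.
Proof.
split.
  apply/bounded_linearP; split; first by move=> k u v; rewrite scaler0 addr0.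
  by exists 0 => u; rewrite normr0 mul0r.
move=> k a b /bounded_linearP[la [M aM]] /bounded_linearP[lb [N bN]].
apply/bounded_linearP; split.
  move=> l u v.
  rewrite -[LHS]/(k *: a (l *: u + v) + b (l *: u + v)).
  rewrite -[RHS]/(l *: (k *: a u + b u) + (k *: a v + b v)) la lb.
  by rewrite !scalerDr !scalerA (mulrC k l) addrACA.
exists (complex.Re `|k| * M + N) => u.
rewrite (le_trans (ler_normD _ _))// [`|_ *: _|]normrZ.
by rewrite rmorphD rmorphM mulrDl lerD//= -mulrA ReK_normC ler_wpM2l// aM.
Qed.

HB.instance Definition _ := GRing.isSubmodClosed.Build R[i] (H -> H)
  bounded_linear_pred bounded_linear_submod_closed.

End BoundedOperators.

Record boundedOp (R : realType) (H : normedModType R[i]) := BoundedOp {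
  boundedOp_fun :> H -> H;
  _ : boundedOp_fun \in bounded_linear_pred }.

Section BoundedOperatorAlgebra.
Context {R : realType} {H : normedModType R[i]}.
Notation BH := (boundedOp H).

HB.instance Definition _ := [isSub for @boundedOp_fun R H].
HB.instance Definition _ := [Choice of BH by <:].
HB.instance Definition _ := [SubChoice_isSubLmodule of BH by <:].

Lemma boundedOp_linear (a : BH) : linear a.
Proof. by case: a => a /= /bounded_linearP[]. Qed.

Lemma boundedOp_bounded (a : BH) :
  exists M : R, forall u, `|a u| <= M%:C * `|u|.
Proof. by case: a => a /= /bounded_linearP[]. Qed.

Lemma boundedOp_comp_subproof (a b : BH) : a \o b \in bounded_linear_pred.
Proof.
apply/bounded_linearP; split.
  by move=> k u v /=; rewrite !boundedOp_linear.
have [M aM] := boundedOp_bounded a; have [N bN] := boundedOp_bounded b.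
exists (`|M| * N) => u /=; rewrite (le_trans (aM _))//.
rewrite (@le_trans _ _ (`|M|%:C * `|b u|))//.
  by rewrite ler_wpM2r// lecR ler_norm.
by rewrite rmorphM -mulrA ler_wpM2l// ler0c.
Qed.

Definition boundedOp_comp (a b : BH) : BH :=
  BoundedOp (boundedOp_comp_subproof a b).

(* Norms of normed modules over R[i] take their values in R[i]; Re recovers the
   underlying nonnegative real number. *)
Definition opnorm (a : BH) : R :=
  sup [set complex.Re `|a u| | u in [set u : H | `|u| <= 1]].

Lemma opnorm_has_sup (a : BH) :
  has_sup [set complex.Re `|a u| | u in [set u : H | `|u| <= 1]].
Proof.
split; first by exists (complex.Re `|a 0|), 0 => //=; rewrite normr0 ler01.
have [M aM] := boundedOp_bounded a; exists `|M| => _ [u /= u1 <-].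
rewrite -lecR ReK_norm (le_trans (aM u))//.
rewrite (@le_trans _ _ (`|M|%:C * `|u|))//.
  by rewrite ler_wpM2r// lecR ler_norm.
by rewrite ler_piMr// ler0c.
Qed.

Lemma opnorm_ge0 (a : BH) : 0 <= opnorm a.
Proof.
apply: (@le_trans _ _ (complex.Re `|a 0|)); first by rewrite -lecR ReK_norm normr_ge0.
apply: sup_upper_bound; first exact: opnorm_has_sup.
by exists 0 => //=; rewrite normr0 ler01.
Qed.

Lemma le_opnorm (a : BH) u : `|a u| <= (opnorm a)%:C * `|u|.
Proof.
have a0 : a 0 = 0.
  have := boundedOp_linear a (-1) 0 0.
  by rewrite !scaleN1r addNr => ->; rewrite addNr.
have aZ k v : a (k *: v) = k *: a v.
  by have := boundedOp_linear a k v 0; rewrite a0 !addr0.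
have [->|u0] := eqVneq u 0; first by rewrite a0 !normr0 mulr0.
rewrite -ler_pdivrMr ?normr_gt0// mulrC.
have -> : `|u|^-1 * `|a u| = `|a (`|u|^-1 *: u)|.
  by rewrite aZ normrZ normfV normr_id.
rewrite -ReK_norm lecR; apply: sup_upper_bound; first exact: opnorm_has_sup.
by exists (`|u|^-1 *: u) => //=; rewrite normrZ normfV normr_id mulVf ?normr_eq0.
Qed.

Lemma opnorm_le (a : BH) (M : R) : 0 <= M ->
  (forall u, `|a u| <= M%:C * `|u|) -> opnorm a <= M.
Proof.
move=> M0 aM; apply: ge_sup; first by have [] := opnorm_has_sup a.
move=> _ [u /= u1 <-]; rewrite -lecR ReK_norm (le_trans (aM u))//.
by rewrite ler_piMr// ler0c.
Qed.

Let norm (a : BH) : R[i] := (opnorm a)%:C.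

Let norm_ler_D (a b : BH) : norm (a + b) <= norm a + norm b.
Proof.
rewrite /norm -rmorphD lecR; apply: opnorm_le.
  by rewrite addr_ge0// opnorm_ge0.
move=> u; rewrite (le_trans (ler_normD _ _))// rmorphD mulrDl.
by rewrite lerD// le_opnorm.
Qed.

Let norm_leZ (k : R[i]) (a : BH) : norm (k *: a) <= `|k| * norm a.
Proof.
rewrite /norm -ReK_normC -rmorphM lecR; apply: opnorm_le.
  by rewrite mulr_ge0 ?opnorm_ge0// -lecR ReK_normC normr_ge0.
move=> u; rewrite rmorphM/= ReK_normC -mulrA [leLHS]normrZ ler_wpM2l//.
exact: le_opnorm.
Qed.

Let normZ (k : R[i]) (a : BH) : norm (k *: a) = `|k| * norm a.
Proof.
apply/eqP; rewrite eq_le norm_leZ/=.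
have [->|k0] := eqVneq k 0.
  by rewrite normr0 mul0r /norm ler0c opnorm_ge0.
rewrite -[in leLHS](scalerK k0 a) mulrC -ler_pdivlMr ?normr_gt0// mulrC.
by rewrite (le_trans (norm_leZ _ _))// normfV.
Qed.

Let norm_eq0 (a : BH) : norm a = 0 -> a = 0.
Proof.
move=> /complexI a0; apply/val_inj/funext => u /=; apply/eqP.
by rewrite -normr_le0 (le_trans (le_opnorm a u))// a0 mul0r.
Qed.

HB.instance Definition _ :=
  Lmodule_isNormed.Build R[i] BH norm_ler_D normZ norm_eq0.

Definition commutator (a b : BH) : BH :=
  boundedOp_comp a b - boundedOp_comp b a.

End BoundedOperatorAlgebra.

Definition separable (T : topologicalType) : Prop :=
  exists D : set T, countable D /\ dense D.

Definition infinite_dimensional (K : fieldType) (V : lmodType K) : Prop :=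
  ~ exists (n : nat) (e : 'I_n -> V),
      forall v : V, exists c : 'I_n -> K, v = \sum_(i < n) c i *: e i.

Section Hilbert.
Context {R : realType} {H : completeNormedModType R[i]}.
Variable dot : {dot H for Num.conj}.

Definition norm_of_dot : Prop := forall u : H, `|u| ^+ 2 = dot u u.

Definition is_adjoint (a b : boundedOp H) : Prop :=
  forall u v : H, dot (a u) v = dot u (b v).

(* a^* = - a *)
Definition skew_adjoint : set (boundedOp H) := [set a | is_adjoint a (- a)].

Definition compact_operator (a : boundedOp H) : Prop :=
  precompact (a @` [set u : H | `|u| <= 1]).

Definition skew_adjoint_compact : set (boundedOp H) :=
  [set a | skew_adjoint a /\ compact_operator a].

Definition square_summable (xi : nat -> H) : Prop :=
  cvgn (series (fun n => complex.Re `|xi n| ^+ 2)).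

(* The ultraweak topology is the coarsest one that makes continuous all the
   functionals a |-> \sum_n <a xi_n, eta_n> with xi and eta square-summable. *)
Definition ultraweak_index : Type :=
  {p : (nat -> H) * (nat -> H) | square_summable p.1 /\ square_summable p.2}.

Definition ultraweak_functional (a : boundedOp H) (p : ultraweak_index) :
    R[i]^o :=
  limn (series (fun n => dot (a ((sval p).1 n)) ((sval p).2 n) : R[i]^o)).

Definition ultraweak_eval (a : boundedOp H) : {ptws ultraweak_index -> R[i]^o} :=
  ultraweak_functional a.

Definition ultraweak : Type := initial_topology ultraweak_eval.
HB.instance Definition _ := Topological.on ultraweak.

Definition ultraweakly_continuous_on (A : set (boundedOp H))
    (f : boundedOp H -> boundedOp H) : Prop :=
  {within (A : set ultraweak), continuous (f : ultraweak -> ultraweak)}.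

End Hilbert.

(* Lie algebras over the reals are presented as real subspaces of a complex
   vector space V with a bracket; a map of such a subset B into itself
   is represented by a function V -> V, whose values outside B are irrelevant.
   Here V is a complex space but linearity is required over R only, since
   skew-adjoint operators do not form a complex subspace. *)
Section LieDerivations.
Context {R : realType} {V : lmodType R[i]}.
Variable bracket : V -> V -> V.

Definition real_linear_endo (B : set V) (D : V -> V) : Prop :=
  (forall x, B x -> B (D x)) /\
  (forall (r : R) x y, B x -> B y -> D (r%:C *: x + y) = r%:C *: D x + D y).

Definition derivation (B : set V) (D : V -> V) : Prop :=
  real_linear_endo B D /\
  (forall x y, B x -> B y ->
     D (bracket x y) = bracket (D x) y + bracket x (D y)).

Definition local_derivation (B : set V) (nabla : V -> V) : Prop :=
  real_linear_endo B nabla /\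
  (forall x, B x -> exists D, derivation B D /\ nabla x = D x).

Definition spatial_derivation (A B : set V) (D : V -> V) : Prop :=
  derivation B D /\
  (exists2 a, A a & forall x, B x -> D x = bracket a x).

Definition local_spatial_derivation (A B : set V) (nabla : V -> V) : Prop :=
  local_derivation B nabla /\
  (forall x, B x -> exists D, spatial_derivation A B D /\ nabla x = D x).

End LieDerivations.

Section MapAlgebras.
Context {R : realType} {H : completeNormedModType R[i]} {Omega : topologicalType}.

Definition pointwise_commutator (x y : Omega -> boundedOp H) :
    Omega -> boundedOp H :=
  fun t => commutator (x t) (y t).

Definition all_maps (A : set (boundedOp H)) : set (Omega -> boundedOp H) :=
  [set x | forall t, A (x t)].

(* The topology on boundedOp H is the one of the operator norm. *)
Definition continuous_maps (A : set (boundedOp H)) :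
    set (Omega -> boundedOp H) :=
  [set x | continuous x /\ forall t, A (x t)].

End MapAlgebras.

(* Main.v *)
(** At a point [t] the map [T a = nabla (cst a) t] is real-linear on [A] and
    of the form [T a = [b_a, a]], and [nabla x t = T (x t)] because
    [nabla x] vanishes wherever [x] does; so it suffices to show that [T] is
    inner. If [p] and [q] are eigenvectors of [a] for the same eigenvalue, then
    [<T a p, q> = 0]. Write [D u v] for the value of the complexification of
    [T] on the rank-one operator [p |-> <p, v> u]. The eigenvector condition,
    applied to [D v v] for all [v], forces [D v v p = <p, v> b v + <p, b v> v]
    for a linear skew map [b], which is bounded by the Hellinger-Toeplitz
    theorem. Hence [T - [b, .]] kills the skew operators of finite rank. Given
    [a] and [p], adding to [a] an operator of rank two makes [p] an
    eigenvector, so [<(T a - [b, a]) p, p> = 0], whence [T a = [b, a]]. *)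

Require Import Defs.
From mathcomp Require Import all_boot all_order all_algebra.
From mathcomp Require Import ring lra.
From mathcomp Require Import complex.
From mathcomp Require Import all_classical all_reals all_analysis.
Import Order.TTheory GRing.Theory Num.Theory.
Import numFieldNormedType.Exports.

Set Implicit Arguments.
Unset Strict Implicit.
Unset Printing Implicit Defensive.

Local Open Scope ring_scope.

(** * Polynomials in a scalar and its conjugate *)

Section ConjPoly.
Variable C : numClosedFieldType.

(** Comparison of coefficients: the values at the eight points 0, 1, -1, ['i], [- 'i], 2, [2 * 'i]
    and [1 + 'i] determine the eight coefficients. *)
Lemma conj_poly_eq0 (c0 c1 c2 c3 c4 c5 c6 c7 : C) :
  (forall l : C, c0 + c1 * l + c2 * l^* + c3 * (l * l^*) + c4 * (l * l)
     + c5 * (l^* * l^*) + c6 * (l * l * l^*) + c7 * (l * l^* * l^*) = 0) ->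
  [/\ [/\ c0 = 0, c1 = 0, c2 = 0 & c3 = 0]
    & [/\ c4 = 0, c5 = 0, c6 = 0 & c7 = 0]].
Proof.
move=> E; have II : 'i * 'i = -1 :> C by rewrite -expr2 sqrCi.
have Ec l l' : l^* = l' -> c0 + c1 * l + c2 * l' + c3 * (l * l') + c4 * (l * l)
    + c5 * (l' * l') + c6 * (l * l * l') + c7 * (l * l' * l') = 0.
  by move=> <-; exact: E.
have e0 := Ec _ _ (conjC0 C); have e1 := Ec _ _ (conjC1 C).
have e2 : c0 - c1 - c2 + c3 + c4 + c5 - c6 - c7 = 0.
  by rewrite -(Ec (-1) (-1)) ?rmorphN ?rmorph1//; ring.
have e3 := Ec _ _ (conjCi C).
have e4 := Ec (- 'i) 'i; rewrite rmorphN /= conjCi opprK in e4.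
have {e4} e4 := e4 erefl.
have e5 := Ec _ _ (conjC_nat C 2).
have e6 := Ec (2 * 'i) (- 2 * 'i).
rewrite rmorphM /= conjCi conjC_nat mulrN mulNr in e6; have {e6} e6 := e6 erefl.
have e7 := Ec (1 + 'i) (1 - 'i).
rewrite rmorphD /= conjC1 conjCi in e7; have {e7} e7 := e7 erefl.
have lc n a b (x y w : C) :
    n != 0 -> x = 0 -> y = 0 -> n * w = a * x + b * y -> w = 0.
  by move=> n0 -> -> /eqP; rewrite !mulr0 addr0 mulf_eq0 (negPf n0) => /eqP.
have n2 : 2 != 0 :> C by rewrite pnatr_eq0.
have n6 : 6 != 0 :> C by rewrite pnatr_eq0.
have nI : 2 * 'i != 0 :> C by rewrite mulf_neq0 ?neq0Ci.
have h0 : c0 = 0 by rewrite -e0; ring.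
rewrite {}h0 in e1 e2 e3 e4 e5 e6 e7 *.
(* Sums over opposite points isolate the monomials of even degree, differences those of odd degree.
   The points of modulus 2 separate degree 1 from degree 3, and [1 + 'i] separates [c4] from
   [c5]. *)
have p1 : c3 + c4 + c5 = 0 by apply: (lc 2 1 1 _ _ _ n2 e1 e2); ring.
have p2 : c3 - c4 - c5 = 0 by apply: (lc 2 1 1 _ _ _ n2 e3 e4); ring: II.
have h3 : c3 = 0 by apply: (lc 2 1 1 _ _ _ n2 p1 p2); ring.
rewrite {}h3 in e5 e6 e7 p1 *.
have p3 : c1 + c2 + c6 + c7 = 0 by apply: (lc 2 1 (-1) _ _ _ n2 e1 e2); ring.
have p4 : c1 - c2 + c6 - c7 = 0.
  by apply: (lc (2 * 'i) 1 (-1) _ _ _ nI e3 e4); ring: II.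
have p5 : c1 + c2 + 4 * c6 + 4 * c7 = 0.
  by apply: (lc 2 1 (-4) _ _ _ n2 e5 p1); ring.
have p6 : c1 - c2 + 4 * c6 - 4 * c7 = 0.
  by apply: (lc (2 * 'i) 1 4 _ _ _ nI e6 p1); ring: II.
have p7 : 3 * (c6 + c7) = 0.
  by apply: (lc 1 1 (-1) _ _ _ _ p5 p3); rewrite ?oner_eq0//; ring.
have p8 : 3 * (c6 - c7) = 0.
  by apply: (lc 1 1 (-1) _ _ _ _ p6 p4); rewrite ?oner_eq0//; ring.
have h6 : c6 = 0 by apply: (lc 6 1 1 _ _ _ n6 p7 p8); ring.
have h7 : c7 = 0 by apply: (lc 6 1 (-1) _ _ _ n6 p7 p8); ring.
rewrite {}h6 {}h7 in p3 p4 e7 *.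
have h1 : c1 = 0 by apply: (lc 2 1 1 _ _ _ n2 p3 p4); ring.
have h2 : c2 = 0 by apply: (lc 2 1 (-1) _ _ _ n2 p3 p4); ring.
rewrite {}h1 {}h2 in e7 *.
have p9 : c4 - c5 = 0.
  by apply: (lc (2 * 'i) 1 0 _ _ _ nI e7 p1); ring: II.
have h4 : c4 = 0 by apply: (lc 2 1 1 _ _ _ n2 p1 p9); ring.
have h5 : c5 = 0 by apply: (lc 2 1 (-1) _ _ _ n2 p1 p9); ring.
by rewrite h4 h5.
Qed.

End ConjPoly.

(** * Inner products and polarization *)

Section Dot.
Variables (C : numClosedFieldType) (H : lmodType C).
Variable dot : {dot H for Num.conj}.

Lemma dotC u v : dot u v = (dot v u)^*.
Proof. by rewrite hermC expr0 mul1r. Qed.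

Lemma dotDl u v w : dot (u + v) w = dot u w + dot v w.
Proof. exact: linearDl. Qed.

Lemma dotDr u v w : dot u (v + w) = dot u v + dot u w.
Proof. exact: linearDr. Qed.

Lemma dotNl u v : dot (- u) v = - dot u v.
Proof. exact: linearNl. Qed.

Lemma dotNr u v : dot u (- v) = - dot u v.
Proof. exact: linearNr. Qed.

Lemma dotZl a u v : dot (a *: u) v = a * dot u v.
Proof. exact: linearZl_LR. Qed.

Lemma dotZr a u v : dot u (a *: v) = a^* * dot u v.
Proof. exact: linearZr_LR. Qed.

Lemma dot0l v : dot 0 v = 0.
Proof. exact: linear0l. Qed.

Lemma dot0r v : dot v 0 = 0.
Proof. exact: linear0r. Qed.

Definition dotE := (dotDl, dotDr, dotNl, dotNr, dotZl, dotZr, dot0l, dot0r).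

Lemma dot_eq0 u : dot u u = 0 -> u = 0.
Proof.
move=> u0; apply/eqP/negPn/negP => /neq0_dnorm_gt0 => /(_ _ dot).
by rewrite u0 ltxx.
Qed.

Lemma dot_inj u v : (forall w, dot u w = dot v w) -> u = v.
Proof.
move=> uv; apply/eqP; rewrite -subr_eq0; apply/eqP/dot_eq0.
by rewrite dotDl dotNl uv subrr.
Qed.

Lemma dot_orthC u v : dot u v = 0 -> dot v u = 0.
Proof. by rewrite dotC => /eqP; rewrite conjC_eq0 => /eqP. Qed.

Lemma dot_real u : (dot u u)^* = dot u u.
Proof. by rewrite -dotC. Qed.

(** Polarization: [B u v] is the coefficient of [l^*] in [B (l *: v + u) (l *: v + u)]. *)
Lemma sesquilinear_eq0 (B : H -> H -> C) :
  (forall a u u' v, B (a *: u + u') v = a * B u v + B u' v) ->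
  (forall a u v v', B u (a *: v + v') = a^* * B u v + B u v') ->
  (forall v, B v v = 0) -> forall u v, B u v = 0.
Proof.
move=> Bl Br B0 u v.
have H0 (l : C) : 0 + B v u * l + B u v * l^* + 0 * (l * l^*) + 0 * (l * l)
    + 0 * (l^* * l^*) + 0 * (l * l * l^*) + 0 * (l * l^* * l^*) = 0.
  by rewrite -[RHS](B0 (l *: v + u)) Bl !Br !B0; ring.
by have [[_ _ ->]] := conj_poly_eq0 H0.
Qed.

Lemma orthogonal_decomposition u p : dot u u != 0 ->
  exists b y, p = b *: u + y /\ dot y u = 0.
Proof.
move=> u0; exists (dot p u / dot u u), (p - (dot p u / dot u u) *: u).
by rewrite addrC subrK dotDl dotNl dotZl divfK// subrr.
Qed.

End Dot.

(** * Locally inner maps on rank-one operators *)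

Section LocalForm.
Variables (C : numClosedFieldType) (H : lmodType C).
Variable dot : {dot H for Num.conj}.
Variable D : H -> H -> H -> H.
Hypothesis D_linear_l : forall a u u' v p,
  D (a *: u + u') v p = a *: D u v p + D u' v p.
Hypothesis D_linear_m : forall a u v v' p,
  D u (a *: v + v') p = a^* *: D u v p + D u v' p.
Hypothesis D_linear_r : forall a u v p p',
  D u v (a *: p + p') = a *: D u v p + D u v p'.
Hypothesis D_herm : forall u v p q, dot (D u v p) q = dot p (D v u q).
(** The eigenvector condition for [v v^*], at the eigenvalue 0 here and at [dot v v] in [D_diag]. *)
Hypothesis D_ortho : forall v p q,
  dot p v = 0 -> dot q v = 0 -> dot (D v v p) q = 0.
Hypothesis D_diag : forall v, dot (D v v v) v = 0.

(** Linear in [u] and [p], conjugate-linear in [v] and [q], so that the hypotheses on [D] become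
    polynomial identities. *)
Let F u v p q := dot (D u v p) q.

Let F1 a u u' v p q : F (a *: u + u') v p q = a * F u v p q + F u' v p q.
Proof. by rewrite /F D_linear_l !dotE. Qed.
Let F2 a u v v' p q : F u (a *: v + v') p q = a^* * F u v p q + F u v' p q.
Proof. by rewrite /F D_linear_m !dotE. Qed.
Let F3 a u v p p' q : F u v (a *: p + p') q = a * F u v p q + F u v p' q.
Proof. by rewrite /F D_linear_r !dotE. Qed.
Let FD4 u v p q q' : F u v p (q + q') = F u v p q + F u v p q'.
Proof. by rewrite /F !dotE. Qed.
Let FZ4 a u v p q : F u v p (a *: q) = a^* * F u v p q.
Proof. by rewrite /F !dotE. Qed.
Let F01 v p q : F 0 v p q = 0.
Proof. by rewrite -[0 in LHS](addNr 0) -[- 0]scaleN1r F1 mulN1r addNr. Qed.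
Let F02 u p q : F u 0 p q = 0.
Proof.
by rewrite -[0 in LHS](addNr 0) -[- 0]scaleN1r F2 rmorphN1 mulN1r addNr.
Qed.
Let F03 u v q : F u v 0 q = 0.
Proof. by rewrite -[0 in LHS](addNr 0) -[- 0]scaleN1r F3 mulN1r addNr. Qed.
Let FZ1 a u v p q : F (a *: u) v p q = a * F u v p q.
Proof. by rewrite -[a *: u]addr0 F1 F01 addr0. Qed.
Let FZ2 a u v p q : F u (a *: v) p q = a^* * F u v p q.
Proof. by rewrite -[a *: v]addr0 F2 F02 addr0. Qed.
Let FZ3 a u v p q : F u v (a *: p) q = a * F u v p q.
Proof. by rewrite -[a *: p]addr0 F3 F03 addr0. Qed.
Let FD1 u u' v p q : F (u + u') v p q = F u v p q + F u' v p q.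
Proof. by rewrite -{1}[u]scale1r F1 mul1r. Qed.
Let FD2 u v v' p q : F u (v + v') p q = F u v p q + F u v' p q.
Proof. by rewrite -{1}[v]scale1r F2 rmorph1 mul1r. Qed.
Let FD3 u v p p' q : F u v (p + p') q = F u v p q + F u v p' q.
Proof. by rewrite -{1}[p]scale1r F3 mul1r. Qed.
Let FE := (FD1, FZ1, FD2, FZ2, FD3, FZ3, FD4, FZ4).
Let FC u v p q : F v u q p = (F u v p q)^*.
Proof. by rewrite /F D_herm dotC. Qed.

Section Normalized.
Variable e : H.
Hypothesis e1 : dot e e = 1.
Hypothesis De0 : forall p, D e e p = 0.

Let F0 p q : F e e p q = 0.
Proof. by rewrite /F De0 dotE. Qed.

Section Orthogonal.
Variable u : H.
Hypothesis ue : dot u e = 0.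
Hypothesis u0 : dot u u != 0.
Let n := dot u u.
Let eu : dot e u = 0. Proof. exact: dot_orthC. Qed.

(* [Foo], [Fo] and [Fu] compare coefficients in [l] of [D_ortho] and [D_diag]
   at [v = l *: e + u]; the vectors orthogonal to [v] are spanned by
   [n *: e - l^* *: u] and the [y] orthogonal to both [e] and [u]. *)
Let Foo y y' : dot y e = 0 -> dot y u = 0 -> dot y' e = 0 -> dot y' u = 0 ->
  [/\ F u u y y' = 0, F u e y y' = 0 & F e u y y' = 0].
Proof.
move=> ye yu y'e y'u.
have E (l : C) : F u u y y' + F e u y y' * l + F u e y y' * l^*
    + 0 * (l * l^*) + 0 * (l * l)
    + 0 * (l^* * l^*) + 0 * (l * l * l^*) + 0 * (l * l^* * l^*) = 0.
  transitivity (F (l *: e + u) (l *: e + u) y y'); last first.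
    by apply: D_ortho; rewrite !dotE ?ye ?yu ?y'e ?y'u; ring.
  by rewrite !FE !F0; ring.
by have [[-> -> -> _] _] := conj_poly_eq0 E.
Qed.

Let nR : n^* = n. Proof. exact: dot_real. Qed.
Let conjN (x : C) : (- x)^* = - x^*. Proof. exact: rmorphN. Qed.

Let Fo y : dot y e = 0 -> dot y u = 0 ->
  [/\ F u u y e = 0, F u e y e = 0, F u e y u = 0, F e u y u = 0
    & F u u y u = n * F e u y e].
Proof.
move=> ye yu.
have E (l : C) : n * F u u y e + (n * F e u y e - F u u y u) * l
    + (n * F u e y e) * l^* + (- F u e y u) * (l * l^*)
    + (- F e u y u) * (l * l)
    + 0 * (l^* * l^*) + 0 * (l * l * l^*) + 0 * (l * l^* * l^*) = 0.
  transitivity (F (l *: e + u) (l *: e + u) y (n *: e + ((- l^*) *: u)));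
    last first.
    by apply: D_ortho; rewrite !dotE ?ye ?yu ?e1 ?ue ?eu -/n; ring.
  by rewrite !FE !F0 nR conjN conjCK; ring.
have [[/eqP a0 /eqP a1 /eqP a2 /eqP a3] [/eqP a4 _ _ _]] := conj_poly_eq0 E.
move: a0 a1 a2 a3 a4.
rewrite !mulf_eq0 !oppr_eq0 (negPf u0) /= subr_eq0.
by move=> /eqP-> /eqP-> /eqP-> /eqP-> /eqP->.
Qed.

Let Fu : [/\ [/\ F u u e e = 0, F u u e u = 0, F u u u e = 0 & F u u u u = 0],
  [/\ F u e e e = 0, F u e u u = 0, F u e u e = 0 & F e u e u = 0],
  F e u e e = 0, F e u u u = 0 & F e u u e = - F u e e u].
Proof.
have E (l : C) : F u u u u + (F u u e u + F e u u u) * l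
    + (F u u u e + F u e u u) * l^*
    + (F u u e e + (F u e e u + F e u u e)) * (l * l^*)
    + F e u e u * (l * l) + F u e u e * (l^* * l^*)
    + F e u e e * (l * l * l^*) + F u e e e * (l * l^* * l^*) = 0.
  transitivity (F (l *: e + u) (l *: e + u) (l *: e + u) (l *: e + u));
    last first.
    exact: D_diag.
  by rewrite !FE !F0; ring.
have [[uu eq1 eq2 eq3] [eueu ueue eeue eue]] := conj_poly_eq0 E.
have E' (l : C) : n * n * F u u e e
    + (n * n * F e u e e - n * F u u e u) * l
    + (n * n * F u e e e - n * F u u u e) * l^*
    + (F u u u u - n * (F u e e u + F e u u e)) * (l * l^*)
    + (- n * F e u e u) * (l * l) + (- n * F u e u e) * (l^* * l^*)
    + F e u u u * (l * l * l^*) + F u e u u * (l * l^* * l^*) = 0.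
  transitivity (F (l *: e + u) (l *: e + u) (n *: e + ((- l^*) *: u))
                 (n *: e + ((- l^*) *: u))); last first.
    by apply: D_ortho; rewrite !dotE ?e1 ?ue ?eu -/n; ring.
  by rewrite !FE !F0 nR conjN conjCK; ring.
have [[Ee _ _ _] [_ _ euuu ueuu]] := conj_poly_eq0 E'.
have h0 : F u u e e = 0.
  by move/eqP: Ee; rewrite !mulf_eq0 (negPf u0) => /eqP.
rewrite ueuu addr0 in eq2; rewrite euuu addr0 in eq1; rewrite h0 add0r in eq3.
by split=> //; apply/eqP; rewrite -addr_eq0 addrC eq3.
Qed.

(** Splitting [p] and [q] along [e], [u] and the complement of both turns each side into a
    combination of the values found in [Foo], [Fo] and [Fu]. *)
Lemma local_form_orthogonal l p q :
  dot (D (l *: e + u) (l *: e + u) p) q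
  = dot p (l *: e + u) * dot (D u e e) q + dot p (D u e e) * dot (l *: e + u) q.
Proof.
rewrite -!D_herm -!/(F _ _ _ _).
have e0 : dot e e != 0 by rewrite e1 oner_eq0.
have dec r : exists a b y,
    [/\ r = a *: e + (b *: u + y), dot y e = 0 & dot y u = 0].
  have [a [r' [-> r'e]]] := orthogonal_decomposition r e0.
  have [b [y [r'E yu]]] := orthogonal_decomposition r' u0.
  exists a, b, y; split=> //; first by rewrite r'E.
  by move: r'e; rewrite r'E !dotE ue mulr0 add0r.
have [a [b [y [-> ye yu]]]] := dec p.
have [a' [b' [y' [-> y'e y'u]]]] := dec q.
have [uuyy ueyy euyy] := Foo ye yu y'e y'u.
have [uuye ueye ueyu euyu uuyu] := Fo ye yu.
(* Conjugation through [FC] moves [y'] from the third to the fourth argument of [F]. *)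
have [/(congr1 Num.conj) uuye' /(congr1 Num.conj) ueye' /(congr1 Num.conj) ueyu'
  /(congr1 Num.conj) euyu' /(congr1 Num.conj) uuyu'] := Fo y'e y'u.
rewrite -!FC conjC0 in uuye' ueye' ueyu' euyu'.
rewrite -FC rmorphM /= nR -FC in uuyu'.
have [[uuee uueu uuue uuuu] [ueee ueuu ueue eueu] euee euuu euue] := Fu.
rewrite !FE !F0 uuyy ueyy euyy uuye ueye ueyu euyu uuyu uuye' ueye' ueyu' euyu'
  uuyu' uuee uueu uuue uuuu ueee ueuu ueue eueu euee euuu euue.
rewrite !dotE e1 ue eu ye yu (dot_orthC y'e) (dot_orthC y'u) -/n; ring.
Qed.

(** What survives is [F u e e u + F e u u e]; since [F u u e e = 0], it is the coefficient of
    [l * l^*] in the expansion of [D_diag]. *)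
Lemma local_form_skew l :
  dot (D u e e) (l *: e + u) + dot (l *: e + u) (D u e e) = 0.
Proof.
rewrite -!D_herm -!/(F _ _ _ _).
have [_ [ueee _ _ _] euee _ euue] := Fu.
by rewrite !FE ueee euee euue; ring.
Qed.

End Orthogonal.

(** If [D u v p = dot p v *: b u + dot p (b v) *: u] and [b e = 0], then taking [v = p = e] forces
    this formula. *)
Let b v := D v e e.

Let bE l u : b (l *: e + u) = b u.
Proof. by rewrite /b D_linear_l De0 scaler0 add0r. Qed.

(** Every [v] is [l *: e + u] with [u] orthogonal to [e], and [b] does not see [l]. The orthogonal
    case applies unless [u = 0], where both sides vanish. Skewness is checked on the diagonal and
    polarized. *)
Lemma normalized_local_form : (forall v p,
    D v v p = dot p v *: b v + dot p (b v) *: v) /\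
  (forall u v, dot (b u) v + dot u (b v) = 0).
Proof.
have e0 : dot e e != 0 by rewrite e1 oner_eq0.
have bP a u u' : b (a *: u + u') = a *: b u + b u' by rewrite /b D_linear_l.
have b0 : b 0 = 0.
  by rewrite -[X in b X](addNr 0) -scaleN1r bP scaleN1r addNr.
have dv v : exists l u, [/\ v = l *: e + u, dot u e = 0 & u = 0 \/ dot u u != 0].
  have [l [u [-> ue]]] := orthogonal_decomposition v e0; exists l, u; split=> //.
  by have [/dot_eq0|] := eqVneq (dot u u) 0; [left|right].
split=> [v p|].
  have [l [u [-> ue [->|u0]]]] := dv v; apply: (@dot_inj _ _ dot) => q.
    rewrite bE b0 addr0 !(dot0r, scaler0, scale0r, addr0, dot0l).
    by rewrite -[LHS]/(F _ _ _ _) FZ1 FZ2 F0 !mulr0.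
  by rewrite local_form_orthogonal// bE !dotE.
apply: sesquilinear_eq0 => [a u u' v|a u v v'|v].
- by rewrite bP !dotE; ring.
- by rewrite bP !dotE; ring.
have [l [u [-> ue [->|u0]]]] := dv v.
  by rewrite bE b0 dot0l dot0r addr0.
by rewrite bE local_form_skew.
Qed.

End Normalized.

End LocalForm.

(** Subtracting from [D] the map induced by the skew operator [b0 x = dot x e *: w - dot x w *: e],
    with [w = D e e e], leads to the normalized case; [b0] is added back at the end. *)
Lemma local_form_inner (C : numClosedFieldType) (H : lmodType C)
    (dot : {dot H for Num.conj}) (D : H -> H -> H -> H) (e : H) :
  (forall a u u' v p, D (a *: u + u') v p = a *: D u v p + D u' v p) ->
  (forall a u v v' p, D u (a *: v + v') p = a^* *: D u v p + D u v' p) ->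
  (forall a u v p p', D u v (a *: p + p') = a *: D u v p + D u v p') ->
  (forall u v p q, dot (D u v p) q = dot p (D v u q)) ->
  (forall v p q, dot p v = 0 -> dot q v = 0 -> dot (D v v p) q = 0) ->
  (forall v, dot (D v v v) v = 0) ->
  dot e e = 1 ->
  exists b : H -> H, [/\ linear b,
    forall u v, dot (b u) v = - dot u (b v) &
    forall v p, D v v p = dot p v *: b v + dot p (b v) *: v].
Proof.
move=> Dl Dm Dr Dh Do Dd e1.
pose w := D e e e; have we : dot w e = 0 by exact: Dd.
have ew : dot e w = 0 by exact: dot_orthC.
have [b0 b0E] : exists b0, forall x, b0 x = dot x e *: w - dot x w *: e.
  by exists (fun x => dot x e *: w - dot x w *: e).
have b0P a x x' : b0 (a *: x + x') = a *: b0 x + b0 x'.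
  by rewrite !b0E !dotE !scalerDl scalerBr !scalerA opprD addrACA.
have b0S u v : dot (b0 u) v + dot u (b0 v) = 0.
  by rewrite !b0E !dotE -!dotC; ring.
have b0C u v : dot u (b0 v) = - dot (b0 u) v.
  by apply/eqP; rewrite -addr_eq0 addrC b0S.
have [D' D'def] : exists D', forall u v p, D' u v p =
    D u v p - (dot p v *: b0 u + dot p (b0 v) *: u).
  by exists (fun u v p => D u v p - (dot p v *: b0 u + dot p (b0 v) *: u)).
have D'E u v p q : dot (D' u v p) q
    = dot (D u v p) q - dot p v * dot (b0 u) q - dot p (b0 v) * dot u q.
  by rewrite D'def !dotE opprD addrA.
have inj x y : (forall q, dot x q = dot y q) -> x = y.
  exact: (@dot_inj _ _ dot).
have [|||||||bD' bS'] := @normalized_local_form _ _ dot D' _ _ _ _ _ _ e e1.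
- move=> a u u' v p; apply: inj => q.
  by rewrite dotDl dotZl !D'E Dl b0P !dotE; ring.
- move=> a u u' v p; apply: inj => q.
  by rewrite dotDl dotZl !D'E Dm b0P !dotE; ring.
- move=> a u u' v p; apply: inj => q.
  by rewrite dotDl dotZl !D'E Dr !dotE; ring.
- move=> u v p q; rewrite [in RHS]dotC !D'E Dh.
  have cB (x y : C) : (x - y)^* = x^* - y^* by exact: rmorphB.
  have cM (x y : C) : (x * y)^* = x^* * y^* by exact: rmorphM.
  by rewrite !cB !cM -!dotC; ring.
- move=> v p q pv qv; rewrite D'E Do// pv (dot_orthC qv); ring.
- move=> v; rewrite D'E Dd b0C; ring.
(* [D' e e = 0]: relative to [e] and its complement, the diagonal blocks of [D e e] vanish by [Do]
   and [Dd], and the off-diagonal ones are given by [w], as they are for [b0]. *)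
- move=> p; apply: inj => q; rewrite D'E dot0l.
  have e0 : dot e e != 0 by rewrite e1 oner_eq0.
  have [a [p' [-> p'e]]] := orthogonal_decomposition p e0.
  have [a' [q' [-> q'e]]] := orthogonal_decomposition q e0.
  rewrite !b0E Dr !dotE (Do e p' q')// (Dh e e p' e) -/w e1 ew we p'e
    (dot_orthC q'e) conjC0 conjC1.
  by move: (a'^*) => c; ring.
exists (fun x => D' x e e + b0 x).
have linb : linear (fun x => D' x e e + b0 x).
  move=> a u u'; apply: inj => q.
  by rewrite !(dotDl, dotZl) !D'E Dl b0P !(dotDl, dotZl); ring.
split=> // [u v|v p].
  rewrite dotDl dotDr b0C opprD opprK; congr (_ + _).
  by apply/eqP; rewrite -addr_eq0 bS'.
apply: inj => q; have /eqP := D'E v v p q.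
rewrite bD' -addrA -opprD eq_sym subr_eq => /eqP->; rewrite !dotE; ring.
Qed.

Local Open Scope classical_set_scope.
Local Open Scope complex_scope.

(** * Norm estimates in the Hilbert space *)

Section HilbertSpace.
Context {R : realType} {H : completeNormedModType R[i]}.
Variable dot : {dot H for Num.conj}.
Hypothesis dot_norm : norm_of_dot dot.

(** The norm of [V] is valued in [R[i]], while the estimates below are made in [R]. Scalars are
    measured as elements of [R[i]^o]. *)
Definition renorm (V : normedModType R[i]) (u : V) : R := complex.Re `|u|.

Lemma renormE (V : normedModType R[i]) (u : V) : (renorm u)%:C = `|u|.
Proof. exact: ReK_norm. Qed.

Lemma renorm_ge0 (V : normedModType R[i]) (u : V) : 0 <= renorm u.
Proof. by rewrite -ler0c renormE. Qed.

Lemma ler_renormD (V : normedModType R[i]) (u v : V) :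
  renorm (u + v) <= renorm u + renorm v.
Proof. by rewrite -lecR rmorphD /= !renormE ler_normD. Qed.

Lemma renormN (V : normedModType R[i]) (u : V) : renorm (- u) = renorm u.
Proof. by rewrite /renorm normrN. Qed.

Lemma renormZ (V : normedModType R[i]) (k : R) (u : V) : 0 <= k ->
  renorm (k%:C *: u) = k * renorm u.
Proof.
move=> k0; apply: complexI; rewrite rmorphM /= !renormE normrZ ger0_norm//.
by rewrite ler0c.
Qed.

Lemma renorm_real (r : R) : 0 <= r -> renorm (r%:C : R[i]^o) = r.
Proof. by move=> r0; apply: complexI; rewrite renormE ger0_norm// ler0c. Qed.

Lemma dot_renorm (u : H) : dot u u = (renorm u ^+ 2)%:C.
Proof. by rewrite -dot_norm rmorphXn /= renormE. Qed.

Lemma cauchy_schwarz (u v : H) : renorm (dot u v : R[i]^o) <= renorm u * renorm v.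
Proof.
rewrite -lecR rmorphM /= !renormE.
have [->|v0] := eqVneq v 0; first by rewrite linear0r !normr0 mulr0.
have n0 : 0 < dot v v by exact: neq0_dnorm_gt0.
rewrite -(@ler_pXn2r _ 2) ?nnegrE ?mulr_ge0// exprMn !dot_norm normCK mulrC.
rewrite -subr_ge0 -(pmulr_rge0 _ n0).
(* The vector on the right is [dot v v] times the component of [u] orthogonal to [v]. *)
have -> : dot v v * (dot u u * dot v v - (dot u v)^*%R * dot u v)
    = dot (dot v v *: u - dot u v *: v) (dot v v *: u - dot u v *: v).
  by rewrite !dotE (dot_real dot v) (dotC dot v u); ring.
by rewrite -dot_norm exprn_ge0.
Qed.

(** * The Hellinger-Toeplitz theorem *)

Section HellingerToeplitz.
Variable b : H -> H.
Hypothesis b_linear : linear b.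
Hypothesis b_skew : forall u v, dot (b u) v = - dot u (b v).

(* Gliding hump: the terms [r ^+ n *: w n] added at step [n] make
   [<x, y n>] at least half of [r ^+ n * |y n|], and the later ones, being
   dominated by a geometric series of ratio [r = 1/4], cannot undo it. *)
Lemma gliding_hump (y : nat -> H) : (forall n, n%:R * 4 ^+ n <= renorm (y n)) ->
  exists x, forall n, n%:R <= 12 * renorm (dot x (y n) : R[i]^o).
Proof.
move=> y_large.
have [w wP] : exists w : nat -> H, forall n,
    renorm (w n) <= 1 /\ renorm (dot (w n) (y n) : R[i]^o) = renorm (y n).
  (* The normalized [y n]; where [y n = 0], the convention [0^-1 = 0] makes it zero. *)
  exists (fun n => ((renorm (y n))^-1)%:C *: y n) => n; split.
    rewrite renormZ ?invr_ge0 ?renorm_ge0//.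
    by have [->|y0] := eqVneq (renorm (y n)) 0; rewrite ?mulr0 ?mulVf.
  rewrite dotZl dot_renorm -rmorphM /=.
  have -> : (renorm (y n))^-1 * renorm (y n) ^+ 2 = renorm (y n).
    have [->|y0] := eqVneq (renorm (y n)) 0; first by rewrite expr0n mulr0.
    by rewrite expr2 mulKf.
  by rewrite renorm_real ?renorm_ge0.
have p4 n : 0 < 4 ^- n :> R by rewrite invr_gt0 exprn_gt0.
(* The pairings of [x] and [x'] with [y n] differ by a number of modulus [4 ^- n * renorm (y n)], so
   the larger one is at least half of it. *)
pose step n x := let x' := x + (4 ^- n)%:C *: w n in
  if renorm (dot x (y n) : R[i]^o) < renorm (dot x' (y n) : R[i]^o)
  then x' else x.
pose x := fix x n := if n is m.+1 then step m (x m) else 0.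
have xS n : renorm (x n.+1 - x n) <= 4 ^- n.
  rewrite /= /step; case: ifP => _; last by rewrite subrr /renorm normr0 ltW.
  rewrite addrC addKr (renormZ _ (ltW (p4 n))) ler_piMr ?(ltW (p4 n))//.
  exact: (wP n).1.
have x_large n :
    4 ^- n * renorm (y n) <= 2 * renorm (dot (x n.+1) (y n) : R[i]^o).
  rewrite -(wP n).2 -(renormZ _ (ltW (p4 n))) /= /step.
  have -> : (4 ^- n)%:C *: (dot (w n) (y n) : R[i]^o)
      = dot (x n + (4 ^- n)%:C *: w n) (y n) - dot (x n) (y n).
    by rewrite dotDl dotZl addrC addKr.
  apply: (le_trans (ler_renormD _ _)); rewrite renormN.
  by case: ifPn => [|]; rewrite -?leNgt; lra.
(* The sum of [4 ^- k] over all [k >= n]. *)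
pose a n : R := 4 / 3 * 4 ^- n.
have x_tail n m : renorm (x (n + m)%N - x n) <= a n - a (n + m)%N.
  elim: m => [|m IH]; first by rewrite addn0 !subrr /renorm normr0.
  rewrite addnS -(subrK (x (n + m)%N) (x (n + m).+1)) -addrA.
  apply: (le_trans (ler_renormD _ _)).
  have -> : a n - a (n + m).+1 = 4 ^- (n + m) + (a n - a (n + m)%N).
    by rewrite /a exprS invfM; lra.
  exact: lerD.
have a_ge0 n : 0 <= a n by rewrite /a mulr_ge0// ltW.
have [l xl] : exists l : H, x @ \oo --> l.
  suff /cvg_ex[l xl] : cvg (x @ \oo) by exists l.
  apply/cauchy_cvgP/cauchy_exP => eps eps0.
  have [e epsE] : exists e, eps = e%:C.
    by exists (complex.Re eps); rewrite RRe_real// gtr0_real.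
  rewrite {}epsE -[0]/(0%:C) ltcR in eps0 *.
  have [n an] : exists n, a n < e.
    exists (Num.truncn (4 / 3 / e)).
    rewrite /a ltr_pdivrMr ?exprn_gt0// [ltRHS]mulrC -ltr_pdivrMr//.
    rewrite (lt_le_trans (truncnS_gt _))//.
    by rewrite -natrX ler_nat ltn_expl.
  exists (x n); rewrite /fmap /=; exists n => // m /= nm.
  rewrite -ball_normE /= distrC -renormE ltcR.
  have := x_tail n (m - n)%N; rewrite subnKC// => /le_lt_trans; apply.
  by apply: le_lt_trans an; rewrite gerBl.
exists l => n.
have [k nk lk] : exists2 k, (n < k)%N & renorm (l - x k) <= 4 ^- n / 12.
  have e0 : 0 < (4 ^- n / 12)%:C :> R[i] by rewrite -[0]/(0%:C) ltcR divr_gt0.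
  have /cvgrPdist_le/(_ _ e0)[N _ lN] := xl.
  exists (n.+1 + N)%N; first exact: leq_addr.
  by rewrite -lecR renormE; apply: lN; rewrite /= leq_addl.
(* 1/12 from the limit and 1/3 from the tail [a n.+1] make 5/12. Against the 1/2 of [x_large] this
   leaves 1/12, whence the factor 12 in the statement. *)
have lx : renorm (l - x n.+1) <= 5 / 12 * 4 ^- n.
  rewrite -(subrK (x k) l) -addrA; apply: (le_trans (ler_renormD _ _)).
  have := x_tail n.+1 (k - n.+1)%N; rewrite subnKC// => xk.
  have : a n.+1 = 4 ^- n / 3 by rewrite /a exprS invfM; lra.
  by move: (a_ge0 k) lk xk; lra.
have := cauchy_schwarz (l - x n.+1) (y n).
have : renorm (l - x n.+1) * renorm (y n) <= 5 / 12 * 4 ^- n * renorm (y n).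
  by rewrite ler_wpM2r// renorm_ge0.
have : renorm (dot (x n.+1) (y n) : R[i]^o) <=
    renorm (dot l (y n) : R[i]^o) + renorm (dot (l - x n.+1) (y n) : R[i]^o).
  rewrite -(renormN (dot (l - _) _ : R[i]^o)).
  have -> : dot (x n.+1) (y n) = dot l (y n) - dot (l - x n.+1) (y n).
    by rewrite dotDl dotNl opprD addNKr opprK.
  exact: ler_renormD.
have : n%:R <= 4 ^- n * renorm (y n).
  by rewrite mulrC ler_pdivlMr ?exprn_gt0.
move: (x_large n); rewrite -!mulrA; lra.
Qed.

(** If [b] is unbounded, some [z n] in the unit ball have [b (z n)] large enough for [gliding_hump],
    which gives an [x] with [dot x (b (z n))] unbounded in [n]. By skewness these numbers are
    bounded by [renorm (b x)]. *)
Lemma hellinger_toeplitz : is_bounded_linear b.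
Proof.
split; first exact: b_linear.
apply: contrapT => b_unbounded.
have /choice[z zP] (n : nat) : exists z,
    renorm z <= 1 /\ n%:R * 4 ^+ n <= renorm (b z).
  apply: contrapT => nz; apply: b_unbounded; exists (n%:R * 4 ^+ n) => u.
  have b0 : b 0 = 0.
    by rewrite -[X in b X](addNr 0) -scaleN1r b_linear scaleN1r addNr.
  have bZ k v : b (k *: v) = k *: b v by rewrite -[k *: v]addr0 b_linear b0 addr0.
  have [->|u0] := eqVneq u 0; first by rewrite b0 !normr0 mulr0.
  have ru : 0 < renorm u.
    by rewrite -ltcR renormE normr_gt0.
  rewrite -!renormE -rmorphM /= lecR leNgt; apply/negP => bu; apply: nz.
  exists ((renorm u)^-1%:C *: u); rewrite bZ !renormZ ?invr_ge0 ?renorm_ge0//.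
  split; first by rewrite mulVf ?gt_eqF.
  by rewrite ler_pdivlMl// mulrC ltW.
have [x xP] := gliding_hump (fun n => (zP n).2).
have bx n : renorm (dot x (b (z n)) : R[i]^o) <= renorm (b x).
  have -> : dot x (b (z n)) = - dot (b x) (z n) by rewrite b_skew opprK.
  rewrite (renormN (dot _ _ : R[i]^o)) (le_trans (cauchy_schwarz _ _))//.
  by rewrite ler_piMr ?renorm_ge0//; exact: (zP n).1.
have := xP (Num.truncn (12 * renorm (b x))).+1.
apply/negP; rewrite -ltNge (le_lt_trans _ (truncnS_gt _))// ler_wpM2l//.
Qed.

End HellingerToeplitz.
End HilbertSpace.

(** * Skew operators, commutators and rank-two operators *)

Section Operators.
Context {R : realType} {H : completeNormedModType R[i]}.
Variable dot : {dot H for Num.conj}.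
Hypothesis dot_norm : norm_of_dot dot.
Implicit Types a b c : boundedOp H.

Lemma conjC_realc (r : R) : Num.conj r%:C = r%:C :> R[i].
Proof. exact: conjc_real. Qed.

Lemma boundedOpP a k u v : a (k *: u + v) = k *: a u + a v.
Proof. exact: boundedOp_linear. Qed.

Lemma boundedOp0 a : a 0 = 0.
Proof. by rewrite -[X in a X](addNr 0) -scaleN1r boundedOpP scaleN1r addNr. Qed.

Lemma boundedOpZ a k u : a (k *: u) = k *: a u.
Proof. by rewrite -[k *: u]addr0 boundedOpP boundedOp0 addr0. Qed.

Lemma boundedOpB a u v : a (u - v) = a u - a v.
Proof. by rewrite addrC -scaleN1r boundedOpP scaleN1r addrC. Qed.

Lemma boundedOp_ext a b : a =1 b -> a = b.
Proof. by move=> ab; apply/val_inj/funext. Qed.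

Lemma boundedOp_addE a b u : (a + b) u = a u + b u. Proof. by []. Qed.
Lemma boundedOp_oppE a u : (- a) u = - a u. Proof. by []. Qed.
Lemma boundedOp_scaleE k a u : (k *: a) u = k *: a u. Proof. by []. Qed.

Lemma commutatorE a b u : commutator a b u = a (b u) - b (a u).
Proof. by []. Qed.

Lemma skew_adjointP a :
  skew_adjoint dot a <-> forall u v, dot (a u) v = - dot u (a v).
Proof.
by split=> h u v; rewrite (h u v) -?(linearNr dot).
Qed.

Lemma skew_adjoint_lin (r : R) a b : skew_adjoint dot a -> skew_adjoint dot b ->
  skew_adjoint dot (r%:C *: a + b).
Proof.
move=> /skew_adjointP sa /skew_adjointP sb; apply/skew_adjointP => u v.
rewrite !(boundedOp_addE, boundedOp_scaleE).
rewrite !dotE sa sb conjC_realc; ring.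
Qed.

Lemma skew_adjoint_commutator a b : skew_adjoint dot a -> skew_adjoint dot b ->
  skew_adjoint dot (commutator a b).
Proof.
move=> /skew_adjointP sa /skew_adjointP sb; apply/skew_adjointP => u v.
by rewrite !commutatorE !dotE !(sa, sb); ring.
Qed.

Lemma commutatorPr k a b b' :
  commutator a (k *: b + b') = k *: commutator a b + commutator a b'.
Proof.
apply: boundedOp_ext => u; apply: (@dot_inj _ _ dot) => v.
rewrite !(commutatorE, boundedOp_addE, boundedOp_scaleE) boundedOpP !dotE; ring.
Qed.

Lemma commutator_jacobi a b c : commutator a (commutator b c) =
  commutator (commutator a b) c + commutator b (commutator a c).
Proof.
apply: boundedOp_ext => u; apply: (@dot_inj _ _ dot) => v.
by rewrite boundedOp_addE !commutatorE !boundedOpB !dotE; ring.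
Qed.

(** As [a] is skew and [mu] imaginary, [b (a p)] and [a (b p)] both pair with [q] to
    [mu * dot (b p) q]. *)
Lemma commutator_eigen a b mu p q : skew_adjoint dot a -> Num.conj mu = - mu ->
  a p = mu *: p -> a q = mu *: q -> dot (commutator b a p) q = 0.
Proof.
move=> /skew_adjointP sa muN ap aq.
by rewrite commutatorE !dotE ap boundedOpZ sa aq !dotE muN; ring.
Qed.

Lemma wedge_subproof u v :
  (fun p => dot p v *: u - dot p u *: v) \in bounded_linear_pred.
Proof.
apply/bounded_linearP; split.
  move=> k p q; rewrite !dotE !scalerDl opprD addrACA.
  by rewrite scalerBr !scalerA.
exists (renorm v * renorm u + renorm u * renorm v) => p.
rewrite -!renormE -rmorphM lecR (le_trans (ler_renormD _ _))// renormN.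
have renormZC (k : R[i]) (w : H) :
    renorm (k *: w) = renorm (k : R[i]^o) * renorm w.
  by apply: complexI; rewrite rmorphM /= !renormE normrZ.
rewrite mulrDl !renormZC lerD// mulrAC ler_wpM2r ?renorm_ge0//.
  by rewrite mulrC cauchy_schwarz.
by rewrite mulrC cauchy_schwarz.
Qed.

(** The operator [u v^* - v u^*], skew and of rank at most two. *)
Definition wedge u v : boundedOp H := BoundedOp (wedge_subproof u v).

Lemma wedgeE u v p : wedge u v p = dot p v *: u - dot p u *: v.
Proof. by []. Qed.

Lemma skew_adjoint_wedge u v : skew_adjoint dot (wedge u v).
Proof.
apply/skew_adjointP => p q.
rewrite !wedgeE !dotE (dotC dot q u) (dotC dot q v).
by rewrite !conjCK; ring.
Qed.

Lemma wedge_linear_l (r : R) u u' v :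
  wedge (r%:C *: u + u') v = r%:C *: wedge u v + wedge u' v.
Proof.
apply: boundedOp_ext => p; apply: (@dot_inj _ _ dot) => q.
rewrite boundedOp_addE boundedOp_scaleE !wedgeE !dotE conjC_realc; ring.
Qed.

Lemma wedgeC u v : wedge u v = - wedge v u.
Proof. by apply: boundedOp_ext => p; rewrite boundedOp_oppE !wedgeE opprB. Qed.

Lemma wedge_opp u v : wedge v (- u) = - wedge v u.
Proof.
apply: boundedOp_ext => p; rewrite boundedOp_oppE !wedgeE linearNr.
by rewrite scalerN opprD opprK scaleNr.
Qed.

Lemma wedgevv u : wedge u u = 0.
Proof. by apply: boundedOp_ext => p; rewrite wedgeE subrr. Qed.

Lemma wedge_imag u v : wedge u ('i%R *: v) = - wedge ('i%R *: u) v.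
Proof.
apply: boundedOp_ext => p; apply: (@dot_inj _ _ dot) => q.
rewrite boundedOp_oppE !wedgeE !dotE conjCi; ring.
Qed.

Lemma skew_eq0 a : skew_adjoint dot a -> (forall p, dot (a p) p = 0) -> a = 0.
Proof.
move=> /skew_adjointP sa a0; apply: boundedOp_ext => p.
apply: (@dot_inj _ _ dot) => q; rewrite [RHS]dot0l.
apply: (@sesquilinear_eq0 _ _ (fun p q => dot (a p) q)) => //.
  by move=> k u u' v; rewrite boundedOpP !dotE.
by move=> k u v v'; rewrite !dotE.
Qed.

(** * Real-linear maps that are locally inner *)

Section Pointwise.
Variable A : set (boundedOp H).
Hypothesis A_skew : A `<=` skew_adjoint dot.
Hypothesis A_lin : forall (r : R) a b, A a -> A b -> A (r%:C *: a + b).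
Hypothesis A_wedge : forall u v, A (wedge u v).
Variable T : boundedOp H -> boundedOp H.
Hypothesis T_lin : forall (r : R) a b, A a -> A b ->
  T (r%:C *: a + b) = r%:C *: T a + T b.
Hypothesis T_local : forall a, A a ->
  exists2 b, skew_adjoint dot b & T a = commutator b a.

Let T_skew a : A a -> skew_adjoint dot (T a).
Proof.
move=> Aa; have [b sb ->] := T_local Aa.
by apply: skew_adjoint_commutator => //; exact: A_skew.
Qed.

Let T_eigen a mu p q : A a -> Num.conj mu = - mu ->
  a p = mu *: p -> a q = mu *: q -> dot (T a p) q = 0.
Proof.
move=> Aa muN ap aq; have [b _ ->] := T_local Aa.
by apply: commutator_eigen muN ap aq; exact: A_skew.
Qed.

Let realcN1 : (-1)%:C = -1 :> R[i].
Proof. by rewrite rmorphN1. Qed.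

Let T0 : T 0 = 0.
Proof.
have Aw := A_wedge 0 0.
by rewrite -[X in T X](addNr (wedge 0 0)) -scaleN1r -realcN1 T_lin// realcN1
  scaleN1r addNr.
Qed.

Let TN a : A a -> T (- a) = - T a.
Proof.
move=> Aa; have A0 : A 0 by rewrite -(wedgevv 0).
by rewrite -scaleN1r -realcN1 -[_ *: _]addr0 T_lin// T0 realcN1 scaleN1r addr0.
Qed.

Let T_wedgeC u v : T (wedge v u) = - T (wedge u v).
Proof. by rewrite wedgeC TN. Qed.

Let T_wedge_imag u v : T (wedge ('i%R *: v) u) = T (wedge ('i%R *: u) v).
Proof. by rewrite T_wedgeC wedge_imag TN// opprK. Qed.

Let T_wedge_linear (k : R[i]) u u' v : T (wedge (k *: u + u') v)
  = (complex.Re k)%:C *: T (wedge u v)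
    + (complex.Im k)%:C *: T (wedge ('i%R *: u) v) + T (wedge u' v).
Proof.
rewrite {1}[k]complexE complexiE scalerDl -addrA wedge_linear_l T_lin//.
by rewrite -addrA mulrC -scalerA wedge_linear_l T_lin.
Qed.

(* [D u v] is the value on [u v^*] of the complexification of [T]. *)
Let D u v p := 2^-1 *: (T (wedge u v) p - 'i%R *: T (wedge ('i%R *: u) v) p).

(** Replacing [u] by ['i *: u] exchanges the two terms of [D] up to the factor ['i], so real
    linearity of [T] becomes complex linearity in [u]. *)
Let D_linear_l k u u' v p : D (k *: u + u') v p = k *: D u v p + D u' v p.
Proof.
have II : 'i%R * 'i%R = -1 :> R[i] by rewrite -expr2 sqrCi.
have iku : 'i%R *: (k *: u + u') = k *: ('i%R *: u) + 'i%R *: u'.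
  by rewrite scalerDr !scalerA mulrC.
have iiu : 'i%R *: ('i%R *: u) = - u by rewrite scalerA II scaleN1r.
rewrite /D iku !T_wedge_linear iiu.
have -> : T (wedge (- u) v) = - T (wedge u v).
  by rewrite !(T_wedgeC v) wedge_opp TN.
apply: (@dot_inj _ _ dot) => q.
rewrite !(boundedOp_addE, boundedOp_oppE, boundedOp_scaleE) !dotE.
rewrite [in RHS](complexE k) complexiE; ring: II.
Qed.

Let D_linear_r k u v p p' : D u v (k *: p + p') = k *: D u v p + D u v p'.
Proof.
apply: (@dot_inj _ _ dot) => q.
by rewrite /D !boundedOpP !dotE; ring.
Qed.

Let T_wedgeE u v p : T (wedge u v) p = D u v p - D v u p.
Proof.
rewrite /D (T_wedge_imag u v) (T_wedgeC u v) boundedOp_oppE.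
by apply: (@dot_inj _ _ dot) => q; rewrite !dotE; field.
Qed.

(** [T (wedge u v)] has adjoint [T (wedge v u)], while ['i] times the skew [T (wedge ('i *: u) v)]
    is self-adjoint and symmetric in [u] and [v]. *)
Let D_herm u v p q : dot (D u v p) q = dot p (D v u q).
Proof.
have sT u' v' p' q' : dot (T (wedge u' v') p') q' = - dot p' (T (wedge u' v') q').
  by have /skew_adjointP -> := T_skew (A_wedge u' v').
rewrite /D (T_wedge_imag u v) (T_wedgeC u v) boundedOp_oppE !dotE !sT.
have -> : Num.conj 2^-1 = 2^-1 :> R[i] by rewrite fmorphV rmorph_nat.
by rewrite conjCi; ring.
Qed.

Let D_linear_m k u v v' p :
  D u (k *: v + v') p = Num.conj k *: D u v p + D u v' p.
Proof.
apply: (@dot_inj _ _ dot) => q.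
by rewrite D_herm D_linear_l dotDr dotZr dotDl (dotZl dot (Num.conj k)) !D_herm.
Qed.

(** [wedge ('i *: v) v] is [2 * 'i] times [v v^*], so a real eigenvalue [l] of the latter gives the
    imaginary eigenvalue [2 * l * 'i]. *)
Let D_eigen v p q l : dot p v *: v = l *: p -> dot q v *: v = l *: q ->
  Num.conj l = l -> dot (D v v p) q = 0.
Proof.
move=> pv qv lR.
have W r : dot r v *: v = l *: r -> wedge ('i%R *: v) v r = (2 * l * 'i%R) *: r.
  move=> rv; rewrite wedgeE dotZr conjCi scalerA mulNr scaleNr opprK -scalerDl.
  have -> : dot r v * 'i%R + 'i%R * dot r v = 2 * 'i%R * dot r v by ring.
  by rewrite -[LHS]scalerA rv scalerA; congr (_ *: _); ring.
rewrite /D wedgevv T0 sub0r dotZl dotNl dotZl.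
have -> : dot (T (wedge ('i%R *: v) v) p) q = 0; last by ring.
apply: (@T_eigen _ (2 * l * 'i%R)); [exact: A_wedge| |exact: W..].
have -> : Num.conj (2 * l * 'i%R)
    = Num.conj 2 * Num.conj l * Num.conj 'i%R :> R[i].
  by rewrite !rmorphM.
by rewrite lR conjCi conjC_nat; ring.
Qed.

Let D_ortho v p q : dot p v = 0 -> dot q v = 0 -> dot (D v v p) q = 0.
Proof.
by move=> pv qv; apply: (@D_eigen _ _ _ 0); rewrite ?pv ?qv ?scale0r// conjC0.
Qed.

Let D_diag v : dot (D v v v) v = 0.
Proof. by apply: (@D_eigen _ _ _ (dot v v)) => //; exact: dot_real. Qed.

Theorem local_inner :
  exists2 b, skew_adjoint dot b & forall a, A a -> T a = commutator b a.
Proof.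
(* A unit vector exists unless [H] is zero, where all operators coincide. *)
have [[e e0]|H0] := pselect (exists e : H, e != 0); last first.
  exists 0; first by apply/skew_adjointP => u v; rewrite linear0l linear0r oppr0.
  move=> a _; apply: boundedOp_ext => u; apply: contrapT => uv; apply: H0.
  have [z|] := eqVneq (T a u) 0; last by exists (T a u).
  by exists (commutator 0 a u); apply/eqP => z'; apply: uv; rewrite z.
pose e' := (renorm e)^-1%:C *: e.
have e'1 : dot e' e' = 1.
  rewrite dotZl dotZr conjC_realc dot_renorm// -!rmorphM /=.
  have re : renorm e != 0.
    by apply: contra_neq e0 => re; apply/eqP; rewrite -normr_eq0 -renormE re.
  by rewrite mulrA -expr2 -exprMn mulVf// expr1n.
have [b [b_lin b_skew DE]] :=
  local_form_inner D_linear_l D_linear_m D_linear_r D_herm D_ortho D_diag e'1.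
have /bounded_linearP b_bnd := hellinger_toeplitz dot_norm b_lin b_skew.
pose b' := BoundedOp b_bnd.
have sb' : skew_adjoint dot b' by apply/skew_adjointP.
exists b' => // a Aa.
(* [DE] covers only [u = v]; both sides are sesquilinear in [u] and [v], so polarization gives the
   rest. *)
have DE2 u v p : D u v p = dot p v *: b u + dot p (b v) *: u.
  apply: (@dot_inj _ _ dot) => q; apply/eqP; rewrite -subr_eq0; apply/eqP.
  apply: (@sesquilinear_eq0 _ _ (fun u v => dot (D u v p) q
      - dot (dot p v *: b u + dot p (b v) *: u) q)).
  - by move=> k x x' y; rewrite D_linear_l b_lin !dotE; ring.
  - by move=> k x y y'; rewrite D_linear_m b_lin !dotE; ring.
  - by move=> x; rewrite DE subrr.
have wedge_inner u v : T (wedge u v) = commutator b' (wedge u v).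
  apply: boundedOp_ext => p; apply: (@dot_inj _ _ dot) => q.
  rewrite T_wedgeE !DE2 commutatorE !wedgeE boundedOpB !boundedOpZ /= !dotE.
  by rewrite !b_skew; ring.
apply/eqP; rewrite -subr_eq0; apply/eqP/skew_eq0.
  rewrite addrC -scaleN1r -realcN1; apply: skew_adjoint_lin; last exact: T_skew.
  by apply: skew_adjoint_commutator => //; exact: A_skew.
move=> p; have [->|p0] := eqVneq p 0; first by rewrite boundedOp0 dot0l.
(* [g] agrees with [dot p p *: a] up to a rank-two operator, and [p] is an
   eigenvector of it. *)
pose r := renorm p ^+ 2; pose g := r%:C *: a + wedge p (a p).
have Ag : A g by apply: A_lin => //; exact: A_wedge.
have gp : g p = dot p (a p) *: p.
  rewrite /g boundedOp_addE boundedOp_scaleE wedgeE dot_renorm// -/r.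
  by rewrite addrC subrK.
have muN : Num.conj (dot p (a p)) = - dot p (a p).
  by rewrite -dotC; have /skew_adjointP -> := A_skew Aa.
(* At [p], the quadratic forms of [T g] and [commutator b' g] both vanish, and the two operators
   have the same [wedge] part. Hence the parts from [a] agree after division by [r]. *)
have := T_eigen Ag muN gp gp; rewrite T_lin// wedge_inner.
have := commutator_eigen b' (A_skew Ag) muN gp gp.
rewrite /g commutatorPr.
set c := commutator b' (wedge _ _); set d := commutator b' a.
rewrite (boundedOp_addE _ c) (boundedOp_addE _ c) !(boundedOp_scaleE r%:C).
rewrite !(dotDl dot (r%:C *: _)) !(dotZl dot r%:C) => d0 Ta0.
have r0 : r%:C != 0.
  by rewrite -(dot_renorm dot_norm); apply: contra_neq p0; exact: dot_eq0.
apply: (mulfI r0); rewrite (boundedOp_addE _ (- d)) (boundedOp_oppE d).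
rewrite (dotDl dot _ (- d p)) (dotNl dot (d p)) mulr0 mulrBr.
move/eqP: d0 Ta0; rewrite addr_eq0 => /eqP-> /eqP; rewrite addr_eq0 => /eqP->.
by rewrite subrr.
Qed.

End Pointwise.

End Operators.

(** * Compact operators *)

Section CompactOperators.
Context {R : realType} {H : completeNormedModType R[i]}.
Variable dot : {dot H for Num.conj}.
Hypothesis dot_norm : norm_of_dot dot.
Implicit Types a b c : boundedOp H.

Lemma boundedOp_continuous a : continuous a.
Proof.
move=> u; apply/cvgrPdist_lt => eps eps0.
have M0 : 0 < (opnorm a)%:C + 1 :> R[i].
  by rewrite ltr_wpDl// ler0c opnorm_ge0.
near=> v.
rewrite -boundedOpB (le_lt_trans (le_opnorm _ _))//.
have uv : `|u - v| < eps / ((opnorm a)%:C + 1).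
  by near: v; apply: cvgr_dist_lt => //; rewrite divr_gt0.
rewrite ltr_pdivlMr// mulrC in uv; apply: le_lt_trans uv.
by rewrite ler_wpM2r// lerDl.
Unshelve. all: by end_near. Qed.

(** Any compact superset may stand for the closure of the image, which makes the stability
    properties direct. *)
Lemma compact_operatorP a :
  compact_operator a <-> exists2 K, compact K & forall u, `|u| <= 1 -> K (a u).
Proof.
split=> [|[K cK aK]].
  rewrite /compact_operator precompactE => ca.
  exists (closure (a @` [set u | `|u| <= 1])) => // u u1.
  by apply: subset_closure; exists u.
apply: (@precompact_subset _ _ K) => [_ [u u1 <-]|]; first exact: aK.
exact/compact_precompact.
Qed.

Lemma compact_image (f : H -> H) (K : set H) :
  continuous f -> compact K -> compact (f @` K).
Proof.
move=> fc; apply: continuous_compact; exact: continuous_subspaceT.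
Qed.

Lemma compact_add (K L : set H) : compact K -> compact L ->
  compact [set x + y | x in K & y in L].
Proof.
move=> cK cL.
have -> : [set x + y | x in K & y in L]
    = (fun z : H * H => z.1 + z.2) @` (K `*` L).
  apply/seteqP; split=> [_ [x Kx [y Ly <-]]|_ [[x y] [/= Kx Ly] <-]].
    by exists (x, y).
  by exists x => //; exists y.
apply: continuous_compact; last exact: compact_setX.
by apply: continuous_subspaceT; exact: add_continuous.
Qed.

Lemma compact_operator_post a c f : continuous f -> (forall u, c u = f (a u)) ->
  compact_operator a -> compact_operator c.
Proof.
move=> fc cE /compact_operatorP[K cK aK]; apply/compact_operatorP.
exists (f @` K); first exact: compact_image.
by move=> u u1; rewrite cE; exists (a u) => //; exact: aK.
Qed.

Lemma compact_operatorD a b : compact_operator a -> compact_operator b ->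
  compact_operator (a + b).
Proof.
move=> /compact_operatorP[K cK aK] /compact_operatorP[L cL bL].
apply/compact_operatorP; exists [set x + y | x in K & y in L].
  exact: compact_add.
by move=> u u1; exists (a u); [exact: aK|exists (b u) => //; exact: bL].
Qed.

Lemma compact_operatorZ k a : compact_operator a -> compact_operator (k *: a).
Proof.
by apply: (@compact_operator_post _ _ ( *:%R k)) => //; exact: scaler_continuous.
Qed.

(** Each product is its compact right factor followed by a continuous map. *)
Lemma compact_operator_commutator a b :
  compact_operator a -> compact_operator b -> compact_operator (commutator a b).
Proof.
move=> ca cb; apply: compact_operatorD.
  exact: (compact_operator_post (@boundedOp_continuous a) _ cb).
rewrite -scaleN1r; apply: compact_operatorZ.
exact: (compact_operator_post (@boundedOp_continuous b) _ ca).
Qed.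

Lemma compact_segment (M : R) (u : H) :
  compact [set x%:C *: u | x in `[- M, M]].
Proof.
apply: (@continuous_compact _ _ (fun x : R => x%:C *: u)); last first.
  exact: segment_compact.
apply: continuous_subspaceT => x; apply/cvgrPdist_lt => eps eps0.
have [e epsE] : exists e, eps = e%:C.
  by exists (complex.Re eps); rewrite RRe_real// gtr0_real.
rewrite {}epsE -[0]/(0%:C) ltcR in eps0 *.
have u0 : 0 < renorm u + 1 by rewrite ltr_wpDl// renorm_ge0.
near=> y.
have xy : `|x - y| < e / (renorm u + 1).
  by near: y; apply: cvgr_dist_lt => //; rewrite divr_gt0.
rewrite ltr_pdivlMr// in xy.
rewrite -scalerBl -rmorphB normrZ -renormE.
rewrite normc_def /= expr0n /= addr0 sqrtr_sqr -rmorphM ltcR.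
by apply: le_lt_trans xy; rewrite ler_wpM2l// lerDl.
Unshelve. all: by end_near. Qed.

(** The unit ball lands in a sum of four segments, for the real and imaginary parts of the
    coefficients of [u] and [v], which Cauchy-Schwarz bounds. *)
Lemma compact_operator_wedge u v : compact_operator (wedge dot_norm u v).
Proof.
pose S M (w : H) := [set x%:C *: w | x in `[- M, M]].
apply/compact_operatorP.
exists [set x + y |
     x in [set x + y | x in S (renorm v) u & y in S (renorm v) ('i *: u)]
   & y in [set x + y | x in S (renorm u) v & y in S (renorm u) ('i *: v)]].
  by do !apply: compact_add; exact: compact_segment.
have SE z M w : renorm (z : R[i]^o) <= M ->
    [set x + y | x in S M w & y in S M ('i *: w)] (z *: w).
  move=> zM; rewrite [z]complexE scalerDl; exists ((complex.Re z)%:C *: w).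
    exists (complex.Re z) => //=; rewrite in_itv /= -ler_norml (le_trans _ zM)//.
    by rewrite -lecR renormE normc_ge_Re.
  exists ((complex.Im z)%:C *: ('i *: w)); last by rewrite scalerA mulrC.
  exists (complex.Im z) => //=; rewrite in_itv /= -ler_norml (le_trans _ zM)//.
  rewrite -lecR renormE.
  have := normc_ge_Re (z * 'i); rewrite ReiNIm normrN normrM.
  by rewrite normCi mulr1.
move=> p p1; have dM w : renorm (dot p w : R[i]^o) <= renorm w.
  rewrite (le_trans (cauchy_schwarz dot_norm _ _))// ler_piMl ?renorm_ge0//.
  by rewrite -lecR renormE.
exists (dot p v *: u); first exact: SE.
exists (- dot p u *: v); last by rewrite scaleNr.
by apply: SE; rewrite (renormN (dot _ _ : R[i]^o)).
Qed.

Lemma skew_adjoint_compact_lin (r : R) a b : skew_adjoint_compact dot a ->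
  skew_adjoint_compact dot b -> skew_adjoint_compact dot (r%:C *: a + b).
Proof.
move=> [sa ca] [sb cb]; split; first exact: skew_adjoint_lin.
by apply: compact_operatorD => //; exact: compact_operatorZ.
Qed.

End CompactOperators.

(** * Continuity of the commutator in operator norm *)

Section CommutatorContinuity.
Context {R : realType} {H : completeNormedModType R[i]}.
Implicit Types a b : boundedOp H.

Lemma opnorm_comp a b : opnorm (boundedOp_comp a b) <= opnorm a * opnorm b.
Proof.
apply: opnorm_le => [|u]; first by rewrite mulr_ge0 ?opnorm_ge0.
rewrite (le_trans (le_opnorm a _))// rmorphM -mulrA ler_wpM2l ?le_opnorm//.
by rewrite ler0c opnorm_ge0.
Qed.

Lemma norm_comp a b : `|boundedOp_comp a b| <= `|a| * `|b|.
Proof. by rewrite -[leLHS]/(opnorm _)%:C -[leRHS]rmorphM lecR opnorm_comp. Qed.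

Lemma cvg_comp_operator (T : Type) (F : set_system T)
    (x y : T -> boundedOp H) a b :
  Filter F -> x @ F --> a -> y @ F --> b ->
  boundedOp_comp (x t) (y t) @[t --> F] --> boundedOp_comp a b.
Proof.
move=> FF xa yb; apply/cvgrPdist_lt => eps eps0.
(* Chosen so that the errors [eps / M * |b|] and [(|a| + 1) * (eps / M)] add up to [eps]. *)
pose M : R[i] := `|a| + `|b| + 1.
have M0 : 0 < M by rewrite ltr_wpDl// addr_ge0.
near=> t.
have -> : boundedOp_comp a b - boundedOp_comp (x t) (y t)
    = boundedOp_comp (a - x t) b + boundedOp_comp (x t) (b - y t).
  apply: boundedOp_ext => u; rewrite -[LHS]/(a (b u) - x t (y t u)).
  rewrite -[RHS]/((a (b u) - x t (b u)) + x t (b u - y t u)) boundedOpB.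
  by rewrite addrA subrK.
rewrite (le_lt_trans (ler_normD _ _))//.
rewrite (@le_lt_trans _ _ (`|a - x t| * `|b| + `|x t| * `|b - y t|))//.
  by rewrite lerD// norm_comp.
have at1 : `|a - x t| < 1 by near: t; apply: cvgr_dist_lt.
have at2 : `|a - x t| < eps / M.
  by near: t; apply: cvgr_dist_lt => //; rewrite divr_gt0.
have bt2 : `|b - y t| < eps / M.
  by near: t; apply: cvgr_dist_lt => //; rewrite divr_gt0.
have xt : `|x t| <= `|a| + 1.
  rewrite -[x t](subrK a) addrC (le_trans (ler_normD _ _))// lerD// distrC ltW//.
have -> : eps = eps / M * `|b| + (`|a| + 1) * (eps / M).
  by rewrite [X in _ + X]mulrC -mulrDr addrA (addrC `|b|) divfK// gt_eqF.
have a1 : 0 < `|a| + 1 by rewrite ltr_wpDl.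
apply: ler_ltD; first by rewrite ler_wpM2r// ltW.
by rewrite (le_lt_trans (ler_wpM2r _ xt))// ltr_pM2l.
Unshelve. all: by end_near. Qed.

Lemma commutator_continuous (Omega : topologicalType)
    (x y : Omega -> boundedOp H) :
  continuous x -> continuous y -> continuous (fun t => commutator (x t) (y t)).
Proof.
move=> xc yc t.
by apply: cvgB; apply: cvg_comp_operator; do ?[exact: xc|exact: yc].
Qed.

End CommutatorContinuity.

(** * From single points of [Omega] to the algebra of maps *)

Theorem theorem6p2
  (R : realType)
  (H : completeNormedModType R[i])
  (dot : {dot H for Num.conj})
  (H_hilbert : norm_of_dot dot)
  (H_separable : separable H)
  (H_infinite : infinite_dimensional H)
  (A : set (boundedOp H))
  (A_def : A = skew_adjoint dot \/ A = skew_adjoint_compact dot)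
  (Omega : topologicalType)
  (L : set (Omega -> boundedOp H))
  (L_def : L = all_maps A \/ L = continuous_maps A)
  (nabla : (Omega -> boundedOp H) -> (Omega -> boundedOp H))
  (nabla_local : local_spatial_derivation pointwise_commutator
     (all_maps (skew_adjoint dot)) L nabla)
  (nabla_uwcont : forall t : Omega,
     ultraweakly_continuous_on dot A (fun a => nabla (cst a) t)) :
  spatial_derivation pointwise_commutator
    (all_maps (skew_adjoint dot)) L nabla.
Proof.
(* These properties let both choices of [A] be treated alike. *)
have [A_skew A_lin A_wedge A_comm] : [/\ A `<=` skew_adjoint dot,
    forall (r : R) a b, A a -> A b -> A (r%:C *: a + b),
    forall u v, A (wedge H_hilbert u v) &
    forall a b, A a -> A b -> A (commutator a b)].
  case: A_def => ->; split.
  - by [].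
  - exact: skew_adjoint_lin.
  - exact: skew_adjoint_wedge.
  - exact: skew_adjoint_commutator.
  - by move=> a [].
  - exact: skew_adjoint_compact_lin.
  - move=> u v; split; [exact: skew_adjoint_wedge|exact: compact_operator_wedge].
  - move=> a b [sa ca] [sb cb]; split; first exact: skew_adjoint_commutator.
    exact: compact_operator_commutator.
have L_val x t : L x -> A (x t) by case: L_def => -> => [|[_]]; exact.
have L_cst a : A a -> L (cst a).
  by case: L_def => -> Aa => [t//|]; split=> // t; exact: cvg_cst.
have L_comm x y : L x -> L y -> L (pointwise_commutator x y).
  case: L_def => -> => [Ax Ay t|[xc Ax] [yc Ay]]; first exact: A_comm.
  by split=> [|t]; [exact: commutator_continuous|exact: A_comm].
have [[[nabla_L nabla_lin] _] nabla_spatial] := nabla_local.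
have L_lin (r : R) x y : L x -> L y -> L (r%:C *: x + y).
  case: L_def => -> => [Ax Ay t|[xc Ax] [yc Ay]]; first exact: A_lin.
  split=> t; last exact: A_lin.
  by apply: cvgD; [apply: cvgZr; exact: xc|exact: yc].
have nabla_inner x : L x -> exists2 a : Omega -> boundedOp H,
    all_maps (skew_adjoint dot) a & forall t, nabla x t = commutator (a t) (x t).
  move=> Lx; have [D [[_ [a sa Da]] nD]] := nabla_spatial x Lx.
  by exists a => // t; rewrite nD Da.
(* [b] is chosen separately at each [t]; the result is admissible since implementing elements range
   over all maps. *)
have /choice[b bP] (t : Omega) : exists b, skew_adjoint dot b /\
    forall a, A a -> nabla (cst a) t = commutator b a.
  have [|||||b sb bE] :=
    @local_inner _ _ _ H_hilbert A _ _ _ (fun a => nabla (cst a) t).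
  - exact: A_skew.
  - exact: A_lin.
  - exact: A_wedge.
  - move=> r a a' Aa Aa'.
    rewrite -[RHS]/((r%:C *: nabla (cst a) + nabla (cst a')) t).
    by rewrite -nabla_lin//; exact: L_cst.
  - move=> a /L_cst/nabla_inner[c sc cE]; exists (c t); [exact: sc|exact: cE].
  by exists b.
have nablaE x t : L x -> nabla x t = commutator (b t) (x t).
  move=> Lx; have Lc := L_cst _ (L_val x t Lx).
  rewrite -(bP t).2; last exact: L_val.
  (* The map [x - cst (x t)] vanishes at [t], hence so does its image under [nabla]. *)
  have [a _ /(_ t)] := nabla_inner _ (L_lin (-1) _ _ Lc Lx).
  rewrite nabla_lin// rmorphN1 !scaleN1r.
  have -> : (- cst (x t) + x) t = 0 by rewrite -[LHS]/(- x t + x t) addNr.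
  have -> : commutator (a t) 0 = 0.
    by apply: boundedOp_ext => u; rewrite commutatorE boundedOp0 subrr.
  by rewrite -[LHS]/(- nabla (cst (x t)) t + nabla x t) addrC => /eqP;
    rewrite subr_eq0 => /eqP.
split; last first.
  by exists b => [t|x Lx]; [exact: (bP t).1|apply/funext => t; rewrite nablaE].
split=> // x y Lx Ly; apply/funext => t.
rewrite nablaE; last exact: L_comm.
(* The Leibniz rule at [t] is the Jacobi identity for [b t]. *)
rewrite [LHS](commutator_jacobi dot).
rewrite -[RHS]/(commutator (nabla x t) (y t) + commutator (x t) (nabla y t)).
by rewrite !nablaE.
Qed.
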